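(* Let $G$ be a bounded graph with edge-perturbed twin subgraphs $X_1$ and $X_2$ (bijection $f$, automorphism $\hat f$), and let $U'(t)=\exp\big(it(A(X_1)-A')\big)$. If $G$ admits an equitable partition $\Pi$ in which $\{a,\hat f(a)\}$ is a cell for every $a\in V(X_1)$, then with $Q=[\mathcal B~~\mathcal C]$, $$Q^TU_G(t)Q=\begin{bmatrix}U'(t)&\mathbf 0\\ \mathbf 0& U_{G/\Pi}(t)\end{bmatrix}\quad\text{for all } t\in\mathbb R.$$
   Context: A graph $G$ has a countable vertex set and a symmetric real weight function $w$ with $w(a,b)\ne0$ iff $\{a,b\}$ is an edge (no loops). $G$ is bounded if $\sum_b|w(a,b)|^2<\infty$ for each $a$ and the absolute degrees $\sum_b|w(a,b)|$ are uniformly bounded; then $A(G)$ ($A(G)_{a,b}=w(a,b)$) is a bounded operator on $\ell^2(V(G))$ and the transition matrix is $U_G(t)=\exp(itA(G))$. $\mathbf e_a$ denotes a standard basis vector. Edge-perturbed twin subgraphs: $G$ connected, $X_1,X_2$ vertex-disjoint induced subgraphs, $f:V(X_1)\to V(X_2)$ a bijection with $w(f(a),f(b))=w(a,b)$ for $a,b\in V(X_1)$, $w(f(a),y)=w(a,y)$ for $a\in V(X_1)$, $y\notin V(X_1)\cup V(X_2)$, and $w(a,f(b))=w(f(a),b)$ for $a,b\in V(X_1)$. $\hat f$ swaps $a$ and $f(a)$ for $a\in V(X_1)$ and fixes all other vertices. $A'$ is the matrix indexed by $V(X_1)$ with $(A')_{u,v}=w(u,f(v))$. A partition $\Pi=\bigcup_jV_j$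 of $V(G)$ into finite cells is equitable if $\sum_{b\in V_k}w(a,b)=c_{jk}$ is independent of $a\in V_j$; $G/\Pi$ has adjacency matrix with $(j,k)$ entry $\operatorname{sign}(c_{jk})\sqrt{c_{jk}c_{kj}}$. $\mathcal C$ is the normalized characteristic matrix of $\Pi$ (column $j$ is $|V_j|^{-1/2}$ times the indicator of $V_j$), and $\mathcal B$ is the matrix whose columns are $\frac1{\sqrt2}(\mathbf e_a-\mathbf e_{\hat f(a)})$, $a\in V(X_1)$. *)

(* Defs.v *)
From HB Require Import structures.
From mathcomp Require Import all_boot all_order all_algebra finmap.
From mathcomp Require Import complex.
From mathcomp Require Import all_classical all_reals all_analysis.
From mathcomp Require Import summability.
From mathcomp Require Import ring lra.

Set Implicit Arguments.
Unset Strict Implicit.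
Unset Printing Implicit Defensive.

Import Order.TTheory GRing.Theory Num.Theory numFieldNormedType.Exports.
Import ComplexField.Normc.

Local Open Scope classical_set_scope.
Local Open Scope ring_scope.

HB.instance Definition _ (R : rcfType) :=
  NormedModule.copy R[i] (R[i] : numFieldType).

Section SquareSummable.
Context {R : realType} {I : choiceType}.
Implicit Types x y : I -> R[i].

Definition sqnorm x : \bar R := (\esum_(i in [set: I]) (normc (x i) ^+ 2)%:E)%E.

Definition sqsummable : {pred I -> R[i]} := fun x => `[< (sqnorm x < +oo)%E >].

Lemma normc_ge0 (z : R[i]) : 0 <= normc z.
Proof. by case: z => a b; exact: sqrtr_ge0. Qed.

Lemma sqnorm_ge0 x : (0 <= sqnorm x)%E.
Proof. by apply: esum_ge0 => i _; rewrite lee_fin sqr_ge0. Qed.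

Lemma esumZ_le (c : R) (u : I -> R) : 0 <= c -> (forall i, 0 <= u i) ->
  (\esum_(i in [set: I]) (c * u i)%:E <= c%:E * \esum_(i in [set: I]) (u i)%:E)%E.
Proof.
move=> c0 u0; apply: ge_ereal_sup => _ [A [finA AT] <-].
under eq_fsbigr do rewrite EFinM.
rewrite -ge0_mule_fsumr; last by move=> i; rewrite lee_fin.
apply: lee_wpmul2l; first by rewrite lee_fin.
by apply: esum_ge; exists A.
Qed.

Lemma sqnormZ_le (c : R[i]) x :
  (sqnorm (c *: x) <= (normc c ^+ 2)%:E * sqnorm x)%E.
Proof.
apply: le_trans (esumZ_le _ _); last 2 first.
- exact: sqr_ge0.
- by move=> i; exact: sqr_ge0.
by apply: le_esum => i _; rewrite lee_fin -exprMn -normcM.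
Qed.

(* Weighted form of 2|a||b| <= e|a|^2 + e^-1|b|^2. *)
Lemma sqnormD_le (e : R) x y : 0 < e ->
  (sqnorm (x + y)%R <= (1 + e)%:E * sqnorm x + (1 + e^-1)%:E * sqnorm y)%E.
Proof.
move=> e0.
have e1 : 0 <= 1 + e by rewrite addr_ge0// ltW.
have e2 : 0 <= 1 + e^-1 by rewrite addr_ge0// invr_ge0 ltW.
apply: le_trans (leeD (esumZ_le e1 _) (esumZ_le e2 _)); last 2 first.
- by move=> i; exact: sqr_ge0.
- by move=> i; exact: sqr_ge0.
rewrite -esumD; last 2 first.
- by move=> i _; rewrite lee_fin mulr_ge0// sqr_ge0.
- by move=> i _; rewrite lee_fin mulr_ge0// sqr_ge0.
apply: le_esum => i _; rewrite -EFinD lee_fin.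
set a := normc (x i); set b := normc (y i).
apply: (@le_trans _ _ ((a + b) ^+ 2)).
  by rewrite ler_sqr ?nnegrE ?le_normcD ?addr_ge0 ?normc_ge0.
rewrite -subr_ge0.
suff -> : (1 + e) * a ^+ 2 + (1 + e^-1) * b ^+ 2 - (a + b) ^+ 2 =
          e^-1 * (e * a - b) ^+ 2.
  by rewrite mulr_ge0 ?sqr_ge0// invr_ge0 ltW.
by field; rewrite gt_eqF.
Qed.

Lemma sqsummable_submod : submod_closed sqsummable.
Proof.
split.
  apply/asboolP; rewrite /sqnorm esum1// => i _.
  by rewrite normc0 expr0n.
move=> c x y /asboolP xoo /asboolP yoo; apply/asboolP.
apply: le_lt_trans (sqnormD_le _ _ ltr01) _.
have cxoo : (sqnorm (c *: x) < +oo)%E.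
  apply: le_lt_trans (sqnormZ_le _ _) _.
  by rewrite lte_mul_pinfty// ?lee_fin ?sqr_ge0.
by rewrite lte_add_pinfty// lte_mul_pinfty// lee_fin ?addr_ge0// ?invr_ge0.
Qed.

HB.instance Definition _ := GRing.isSubmodClosed.Build _ _ sqsummable
  sqsummable_submod.

Record ell2 := Ell2 { ell2_fun :> I -> R[i]; _ : ell2_fun \in sqsummable }.
HB.instance Definition _ := [isSub for ell2_fun].
HB.instance Definition _ := [Choice of ell2 by <:].
HB.instance Definition _ := [SubChoice_isSubLmodule of ell2 by <:].


Lemma ell2_fin (x : ell2) : sqnorm x \is a fin_num.
Proof.
rewrite ge0_fin_numE ?sqnorm_ge0//.
by case: x => x /= /asboolP.
Qed.

Definition ell2_norm (x : ell2) : R := Num.sqrt (fine (sqnorm x)).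

Lemma sqr_ell2_norm (x : ell2) : ell2_norm x ^+ 2 = fine (sqnorm x).
Proof. by rewrite sqr_sqrtr// fine_ge0// sqnorm_ge0. Qed.

Lemma ell2_norm_eq0 (x : ell2) : ell2_norm x = 0 -> x = 0.
Proof.
move=> /(congr1 (fun u => u ^+ 2)); rewrite sqr_ell2_norm [RHS]expr2 mul0r => x0.
apply: val_inj; apply: funext => i /=; apply: eq0_normc.
have xE : sqnorm x = 0%:E by rewrite -x0 fineK ?ell2_fin.
apply/eqP; rewrite -sqrf_eq0 eq_le sqr_ge0 andbT -lee_fin -xE.
apply: esum_ge; exists [set i]; first by split=> //; exact: finite_set1.
by rewrite fsbig_set1.
Qed.

Lemma ell2_normD (x y : ell2) : ell2_norm (x + y) <= ell2_norm x + ell2_norm y.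
Proof.
have [/ell2_norm_eq0->|x0] := eqVneq (ell2_norm x) 0.
  by rewrite add0r lerDr sqrtr_ge0.
have [/ell2_norm_eq0->|y0] := eqVneq (ell2_norm y) 0.
  by rewrite addr0 lerDl sqrtr_ge0.
have xp : 0 < ell2_norm x by rewrite lt0r x0 sqrtr_ge0.
have yp : 0 < ell2_norm y by rewrite lt0r y0 sqrtr_ge0.
rewrite -ler_sqr ?nnegrE ?addr_ge0 ?sqrtr_ge0// sqr_ell2_norm.
rewrite -lee_fin fineK ?ell2_fin//.
apply: le_trans (sqnormD_le _ _ (divr_gt0 yp xp)) _.
rewrite -(fineK (ell2_fin x)) -(fineK (ell2_fin y)) -!sqr_ell2_norm.
rewrite -!EFinM -EFinD lee_fin le_eqVlt; apply/orP; left; apply/eqP.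
by field; rewrite x0 y0.
Qed.

Lemma ell2_normZ (c : R[i]) (x : ell2) :
  ell2_norm (c *: x) = normc c * ell2_norm x.
Proof.
have le_normZ (d : R[i]) (y : ell2) :
    ell2_norm (d *: y) <= normc d * ell2_norm y.
  rewrite -ler_sqr ?nnegrE ?mulr_ge0 ?sqrtr_ge0 ?normc_ge0//.
  rewrite exprMn !sqr_ell2_norm -lee_fin EFinM !fineK ?ell2_fin//.
  exact: sqnormZ_le.
have [->|c0] := eqVneq c 0.
  apply/eqP; rewrite eq_le le_normZ normc0 mul0r sqrtr_ge0.
  by [].
apply/eqP; rewrite eq_le le_normZ/=.
have nc0 : 0 < normc c.
  rewrite lt0r normc_ge0 andbT; apply: contra c0 => /eqP/eq0_normc ->.
  exact: eqxx.
rewrite -ler_pdivlMl// -normcV; apply: le_trans (le_normZ _ _).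
by rewrite scalerA mulVf// scale1r.
Qed.

Definition ell2_normC (x : ell2) : R[i] := (ell2_norm x)%:C%C.

Lemma ler_ell2_normD (x y : ell2) :
  ell2_normC (x + y) <= ell2_normC x + ell2_normC y.
Proof. by rewrite -rmorphD lecR ell2_normD. Qed.

Lemma ell2_normCZ (c : R[i]) (x : ell2) :
  ell2_normC (c *: x) = `|c| * ell2_normC x.
Proof. by rewrite /ell2_normC ell2_normZ rmorphM; case: c. Qed.

Lemma ell2_normC_eq0 (x : ell2) : ell2_normC x = 0 -> x = 0.
Proof. by move=> [] /ell2_norm_eq0. Qed.

HB.instance Definition _ := Lmodule_isNormed.Build R[i] ell2
  ler_ell2_normD ell2_normCZ ell2_normC_eq0.

Lemma basis_sqsummable (b : I) :
  (fun a => (a == b)%:R : R[i]) \in sqsummable.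
Proof.
apply/asboolP; rewrite /sqnorm.
rewrite (esumID [set b])//; last by move=> i _; rewrite lee_fin sqr_ge0.
rewrite setTI esum_set1 ?lee_fin ?sqr_ge0// eqxx esum1 ?adde0 ?ltry// => i [_].
by move=> /eqP /negPf /= ->; rewrite normc0 expr0n.
Qed.

Definition basis_vec (b : I) : ell2 := Ell2 (basis_sqsummable b).

End SquareSummable.
Arguments ell2 : clear implicits.

Section InfiniteMatrices.
Context {R : realType}.
Implicit Types I J K : choiceType.

Definition imx I J := I -> J -> R[i].

(* [summability.sum] is the unconditional sum: the limit of the sums over finite
   sets of indices. *)
Definition imx_mul I J K (M : imx I J) (N : imx J K) : imx I K :=
  fun i k => summability.sum (fun j => M i j * N j k).

Definition imx_tr I J (M : imx I J) : imx J I := fun j i => M i j.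

Definition imx_row I J K (M : imx I J) (N : imx I K) : imx I (J + K)%type :=
  fun i jk => match jk with inl j => M i j | inr k => N i k end.

Definition imx_diag I J (M : imx I I) (N : imx J J) :
    imx (I + J)%type (I + J)%type :=
  fun p q => match p, q with
  | inl i, inl i' => M i i'
  | inr j, inr j' => N j j'
  | _, _ => 0
  end.

(* The value [0] is only taken at those [x] for which [M x] is not square
   summable; there are none when [M] is the matrix of a bounded operator. *)
Definition op_of_imx I J (M : imx I J) (x : ell2 R J) : ell2 R I :=
  insubd 0 (fun i => summability.sum (fun j => M i j * x j)).

Definition imx_of_op I J (T : ell2 R J -> ell2 R I) : imx I J :=
  fun i j => T (basis_vec j) i.

(* For a bounded operator [T] the exponential series converges in operator
   norm, hence at every vector; the limit is taken in the norm of [ell2]. *)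
Definition op_exp I (T : ell2 R I -> ell2 R I) (x : ell2 R I) : ell2 R I :=
  limn (series (fun n => (n`!%:R : R[i])^-1 *: iter n T x)).

Definition transition_imx I (M : imx I I) (t : R) : imx I I :=
  imx_of_op (op_exp (fun x => (0 +i* t)%C *: op_of_imx M x)).

End InfiniteMatrices.
Arguments imx : clear implicits.

Record graph (R : realType) (V : countType) := Graph {
  weight :> V -> V -> R;
  weight_sym : forall a b, weight a b = weight b a;
  weight_loopless : forall a, weight a a = 0 }.

Section Graphs.
Context {R : realType} {V : countType}.
Implicit Types (G : graph R V) (X : set V).

Definition bounded_graph G : Prop :=
  (forall a, \esum_(b in [set: V]) (`|G a b| ^+ 2)%:E < +oo)%E /\
  exists D : R, (forall a, \esum_(b in [set: V]) `|G a b|%:E <= D%:E)%E.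

Definition connected_graph G : Prop :=
  forall a b, exists p : seq V, path (fun u v => G u v != 0) a p /\ last a p = b.

Definition adj_imx G : imx R V V := fun a b => (G a b)%:C%C.

Definition induced_subgraph G X : graph R X :=
  @Graph R X (fun u v => G (val u) (val v))
    (fun u v => weight_sym G (val u) (val v))
    (fun u => weight_loopless G (val u)).

Record edge_perturbed_twins G (X1 X2 : set V) (f : V -> V) : Prop := {
  twins_connected : connected_graph G;
  twins_disjoint : X1 `&` X2 = set0;
  twins_bij : set_bij X1 X2 f;
  twins_inner : forall a b, X1 a -> X1 b -> G (f a) (f b) = G a b;
  twins_outer : forall a y, X1 a -> ~ X1 y -> ~ X2 y -> G (f a) y = G a y;
  twins_cross : forall a b, X1 a -> X1 b -> G a (f b) = G (f a) b }.

Definition twin_swap (X1 X2 : set V) (f : V -> V) (x : V) : V :=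
  if x \in X1 then f x else if x \in X2 then 'pinv_id X1 f x else x.

Definition cross_imx G X (f : V -> V) : imx R X X :=
  fun u v => (G (val u) (f (val v)))%:C%C.

Definition twin_imx (X1 X2 : set V) (f : V -> V) : imx R V X1 := fun x a =>
  ((Num.sqrt 2)^-1 *
    ((x == val a)%:R - (x == twin_swap X1 X2 f (val a))%:R))%:C%C.

(* The [c j k] are determined by [cell], since cells are nonempty. *)
Definition equitable G (J : countType) (cell : J -> {fset V})
    (c : J -> J -> R) : Prop :=
  partition [set: J] (fun j => [set` cell j]) [set: V] /\
  forall j k a, a \in cell j -> \sum_(b <- cell k) G a b = c j k.

Definition char_imx (J : countType) (cell : J -> {fset V}) : imx R V J :=
  fun x j => ((Num.sqrt (#|` cell j|)%:R)^-1 * (x \in cell j)%:R)%:C%C.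

End Graphs.
Arguments induced_subgraph {R V} G X.
Arguments cross_imx {R V} G X f.
Arguments twin_imx {R V} X1 X2 f.

(* Adjacency matrix of the quotient of a graph by an equitable partition with
   row sums [c]; its diagonal may be nonzero. *)
Definition quotient_imx (R : realType) (J : countType) (c : J -> J -> R) :
    imx R J J :=
  fun j k => (Num.sg (c j k) * Num.sqrt (c j k * c k j))%:C%C.

(* Main.v *)
(* The columns of B are supported on the disjoint pairs {a, f a}, those of C on
   the disjoint cells of the partition; each family is orthonormal, so B and C
   give isometries between [ell2] spaces. Comparing matrix entries, which are
   finite sums, A(G) B = B (A(X1) - A') and A(G) C = C A(G/Pi). These identities
   extend to all square-summable vectors by summing cell by cell, hence pass to
   the exponential series: U_G(t) B = B U'(t) and U_G(t) C = C U_{G/Pi}(t).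
   Since B^T B = 1, C^T C = 1 and B^T C = 0, multiplying by Q^T on the left
   gives the block form. Boundedness of A(G) is Schur's test; that of the two
   small operators is inherited through the isometries. *)

Require Import Defs.
From mathcomp Require Import all_boot all_order all_algebra finmap.
From mathcomp Require Import complex.
From mathcomp Require Import all_classical all_reals all_analysis.
From mathcomp Require Import summability ring lra.
Import Order.TTheory GRing.Theory Num.Theory numFieldNormedType.Exports.
Import ComplexField.Normc.
Local Open Scope classical_set_scope.
Local Open Scope ring_scope.

(** * Convergence in the complex numbers *)

Section ComplexConvergence.
Context {R : realType}.
Implicit Types z w : R[i].

Lemma normr_complexE z : `|z| = (normc z)%:C%C.
Proof. by []. Qed.

Lemma normc_real (x : R) : normc x%:C%C = `|x|.
Proof. by rewrite /= expr0n addr0 sqrtr_sqr. Qed.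

Lemma normc_sub z w : normc (z - w) = normc (w - z).
Proof. by apply: (@complexI R); rewrite -!normr_complexE distrC. Qed.

Lemma le_normc_Re z : `|complex.Re z| <= normc z.
Proof. by rewrite -lecR; exact: normc_ge_Re. Qed.

Lemma le_normc_Im z : `|complex.Im z| <= normc z.
Proof.
by case: z => a b /=; rewrite -sqrtr_sqr ler_wsqrtr// lerDr sqr_ge0.
Qed.

Lemma normc_le_ReIm z : normc z <= `|complex.Re z| + `|complex.Im z|.
Proof.
case: z => a b; have -> : (a +i* b)%C = a%:C%C + (0 +i* b)%C.
  by apply/eqP; rewrite eq_complex /= addr0 add0r !eqxx.
apply: le_trans (le_normcD _ _) _.
by rewrite normc_real /= expr0n/= add0r sqrtr_sqr !add0r !addr0.
Qed.

Lemma normc_sum {I : Type} (r : seq I) (P : pred I) (z : I -> R[i]) :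
  normc (\sum_(i <- r | P i) z i) <= \sum_(i <- r | P i) normc (z i).
Proof.
apply: (big_rec2 (fun x y => normc x <= y)) => [|i x y Pi xy].
  by rewrite normc0.
by apply: le_trans (le_normcD _ _) _; rewrite lerD2l.
Qed.

Lemma pos_complexP (e : R[i]) : 0 < e -> exists2 d : R, 0 < d & e = d%:C%C.
Proof.
case: e => a b; rewrite ltcE /= => /andP[/eqP b0 a0].
by exists a => //; rewrite b0.
Qed.

Section Filters.
Context {T : Type} {F : set_system T}.

Lemma cvg_normcP {FF : Filter F} (z : T -> R[i]) l :
  z @ F --> l <-> forall e : R, 0 < e -> \forall t \near F, normc (l - z t) < e.
Proof.
split=> [/cvgrPdist_lt zl e e0|zl].
  have /zl : 0 < e%:C%C by rewrite ltcR.
  by apply: filterS => t; rewrite normr_complexE ltcR.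
apply/cvgrPdist_lt => _ /pos_complexP[e e0 ->].
by apply: filterS (zl e e0) => t; rewrite normr_complexE ltcR.
Qed.

(** Real and imaginary parts do not increase distances, so both are Cauchy along [F] and converge by
    completeness of [R]. The centre [w] need not be a value of [z]. *)
Lemma cauchy_normc_cvg {FF : ProperFilter F} (z : T -> R[i]) :
  (forall e : R, 0 < e -> exists w, \forall t \near F, normc (w - z t) < e) ->
  cvg (z @ F).
Proof.
move=> zC.
have part (p : R[i] -> R) : (forall z, `|p z| <= normc z) ->
    (forall z w, p (z - w) = p z - p w) -> cvg ((p \o z) @ F).
  move=> ple pB; apply/cauchy_cvgP/cauchy_exP => e e0.
  have [w zw] := zC e e0; exists (p w).
  apply: filterS zw => t /=; rewrite /ball /=; apply: le_lt_trans.
  by rewrite -pB.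
have /cvg_ex[a /cvgrPdist_lt za] := part _ le_normc_Re (raddfB _).
have /cvg_ex[b /cvgrPdist_lt zb] := part _ le_normc_Im (raddfB _).
apply/cvg_ex; exists (a +i* b)%C; apply/cvg_normcP => e e0.
have e20 : 0 < e / 2 by rewrite divr_gt0.
near=> t; apply: le_lt_trans (normc_le_ReIm _) _.
rewrite [e]splitr !raddfB /= ltrD//; near: t; [exact: za|exact: zb].
Unshelve. all: by end_near. Qed.

Lemma cvg_normc_le {FF : ProperFilter F} (z : T -> R[i]) l (B : R) :
  z @ F --> l -> (\forall t \near F, normc (z t) <= B) -> normc l <= B.
Proof.
move=> /cvg_normcP zl zB; apply/ler_addgt0Pr => e e0.
have [t [tB te]] := filter_ex (filterI zB (zl e e0)).
rewrite -[l](subrK (z t)); apply: le_trans (le_normcD _ _) _.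
by rewrite addrC lerD// ltW.
Qed.

End Filters.
End ComplexConvergence.

(** * Unconditional sums and completeness of ell2 *)

#[local] Existing Instance totally_filter.

Section UnconditionalSums.
Context {R : realType} {I : choiceType}.

Lemma partial_sumE (x : I -> R[i]) (A : {fset I}) :
  partial_sum x A = \sum_(i <- A) x i.
Proof. by rewrite /partial_sum big_seq_fsetE. Qed.

Lemma near_totally (P : {fset I} -> Prop) (A : {fset I}) :
  (forall B : {fset I}, (A `<=` B)%fset -> P B) -> \forall B \near totally, P B.
Proof. by move=> AP; exists A. Qed.

Lemma sum_fset_subset {M : zmodType} {x : I -> M} {A B : {fset I}} :
  (A `<=` B)%fset ->
  \sum_(i <- B) x i = \sum_(i <- A) x i + \sum_(i <- (B `\` A)%fset) x i.
Proof.
move=> AB; rewrite (big_fsetID _ (mem A)) /=; congr (_ + _).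
  by apply: eq_fbigl => i; rewrite !inE andbC; apply: andb_idr; move/(fsubsetP AB).
by apply: eq_fbigl => i; rewrite !inE andbC.
Qed.

Lemma fset_le_esum (u : I -> R) (A : {fset I}) :
  ((\sum_(i <- A) u i)%:E <= \esum_(i in [set: I]) (u i)%:E)%E.
Proof.
apply: esum_ge; exists [set` A]; first by split.
by rewrite fsbig_finite// set_fsetK sumEFin.
Qed.

Lemma esum_le_fset (u : I -> R) (B : \bar R) :
  (forall A : {fset I}, (\sum_(i <- A) u i)%:E <= B)%E ->
  (\esum_(i in [set: I]) (u i)%:E <= B)%E.
Proof.
move=> uB; apply: ge_ereal_sup => _ [X [finX _] <-].
by rewrite fsbig_finite// sumEFin.
Qed.

Lemma cvg_finite_support (x : I -> R[i]) (A : {fset I}) :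
  (forall i, i \notin A -> x i = 0) ->
  partial_sum x @ totally --> \sum_(i <- A) x i.
Proof.
move=> xA; apply/cvg_normcP => e e0; apply: (near_totally _ A) => B AB.
rewrite partial_sumE (big_fset_incl _ AB) ?subrr ?normc0//.
by move=> i _ /xA.
Qed.

Lemma sumE (x : I -> R[i]) (l : R[i]) :
  partial_sum x @ totally --> l -> summability.sum x = l.
Proof. by move=> xl; apply: cvg_lim => //; exact: norm_hausdorff. Qed.

Lemma sum_finite_support (x : I -> R[i]) (A : {fset I}) :
  (forall i, i \notin A -> x i = 0) -> summability.sum x = \sum_(i <- A) x i.
Proof. by move=> /cvg_finite_support /sumE. Qed.

(** A finite [A] carrying all but [e] of the absolute sum witnesses the Cauchy property: enlarging
    it changes the sum by less than [e]. *)
Lemma abs_summable_cvg (x : I -> R[i]) :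
  (\esum_(i in [set: I]) (normc (x i))%:E < +oo)%E ->
  cvg (partial_sum x @ totally).
Proof.
move=> xoo; set S := esum _ _ in xoo.
have Sfin : S \is a fin_num.
  by rewrite ge0_fin_numE// esum_ge0// => i _; rewrite lee_fin normc_ge0.
apply: cauchy_normc_cvg => e e0.
have : (S - e%:E < S)%E by rewrite -(fineK Sfin) -EFinB lte_fin gtrBl.
case/ereal_sup_gt => _ [X [finX _] <-]; rewrite fsbig_finite// sumEFin.
set A := fset_set X => SA.
exists (\sum_(i <- A) x i); apply: (near_totally _ A) => B AB.
rewrite partial_sumE (sum_fset_subset AB) opprD addNKr -sub0r normc_sub subr0.
apply: le_lt_trans (normc_sum _ _ _) _.
have := fset_le_esum (fun i => normc (x i)) B.
rewrite -/S (sum_fset_subset AB) => BS.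
move: SA BS; rewrite -(fineK Sfin) -EFinB lte_fin lee_fin; lra.
Qed.

End UnconditionalSums.

Section Ell2Space.
Context {R : realType} {I : choiceType}.
Implicit Types x y : ell2 R I.

Lemma ell2_norm_ge0 x : 0 <= ell2_norm x.
Proof. exact: sqrtr_ge0. Qed.

Lemma ell2_normE x : `|x| = (ell2_norm x)%:C%C.
Proof. by []. Qed.

Lemma ell2_norm0 : ell2_norm (0 : ell2 R I) = 0.
Proof. by apply: (@complexI R); rewrite -ell2_normE normr0. Qed.

Lemma ell2_norm_sub x y : ell2_norm (x - y) = ell2_norm (y - x).
Proof. by apply: (@complexI R); rewrite -!ell2_normE distrC. Qed.

Lemma sqnormE x : sqnorm x = (ell2_norm x ^+ 2)%:E.
Proof. by rewrite sqr_ell2_norm fineK// ell2_fin. Qed.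

Lemma fset_le_ell2_norm x (A : {fset I}) :
  \sum_(i <- A) normc (x i) ^+ 2 <= ell2_norm x ^+ 2.
Proof. by rewrite -lee_fin -sqnormE; exact: fset_le_esum. Qed.

Lemma normc_le_ell2_norm x i : normc (x i) <= ell2_norm x.
Proof.
rewrite -ler_sqr ?nnegrE ?normc_ge0 ?ell2_norm_ge0//.
by have := fset_le_ell2_norm x [fset i]%fset; rewrite big_seq_fset1.
Qed.

Lemma ell2_norm_sum {T : Type} (r : seq T) (P : pred T) (x : T -> ell2 R I) :
  ell2_norm (\sum_(i <- r | P i) x i) <= \sum_(i <- r | P i) ell2_norm (x i).
Proof.
elim/(@big_rec2 (ell2 R I) R): _ => [|i v u Pi uv].
  by rewrite ell2_norm0.
by apply: le_trans (ell2_normD _ _) _; rewrite lerD2l.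
Qed.

Lemma ell2_sumE {T : Type} (r : seq T) (P : pred T) (x : T -> ell2 R I) i :
  (\sum_(k <- r | P k) x k) i = \sum_(k <- r | P k) x k i.
Proof. by apply: (big_morph (fun x : ell2 R I => x i)). Qed.

Lemma ell2_ext x y : (forall i, x i = y i) -> x = y.
Proof. by move=> xy; apply: val_inj; apply/funext. Qed.

Section Filters.
Context {T : Type} {F : set_system T}.

Lemma cvg_ell2P {FF : Filter F} (x : T -> ell2 R I) (l : ell2 R I) :
  x @ F --> l <->
  forall e : R, 0 < e -> \forall t \near F, ell2_norm (l - x t) < e.
Proof.
split=> [/cvgrPdist_lt xl e e0|xl].
  have /xl : 0 < e%:C%C by rewrite ltcR.
  by apply: filterS => t; rewrite ell2_normE ltcR.
apply/cvgrPdist_lt => _ /pos_complexP[e e0 ->].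
by apply: filterS (xl e e0) => t; rewrite ell2_normE ltcR.
Qed.

(* The coordinates converge, and Fatou's lemma bounds the distance from a term
   of the family to the coordinatewise limit. *)
Lemma cauchy_ell2_cvg {FF : ProperFilter F} (x : T -> ell2 R I) :
  (forall e : R, 0 < e ->
    exists y, \forall t \near F, ell2_norm (y - x t) <= e) ->
  cvg (x @ F).
Proof.
move=> xC.
have xcvg i : cvg ((fun t => x t i) @ F).
  apply: cauchy_normc_cvg => e e0.
  have e20 : 0 < e / 2 by rewrite divr_gt0.
  have [y xy] := xC _ e20; exists (y i); apply: filterS xy => t xy.
  apply: le_lt_trans (normc_le_ell2_norm (y - x t) i) _.
  by apply: le_lt_trans xy _; rewrite ltr_pdivrMr// mulr_natr mulr2n ltrDr.
pose l : I -> R[i] := fun i => lim ((fun t => x t i) @ F).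
have xl i : (fun t => x t i) @ F --> l i := xcvg i.
have ly (e : R) (y : ell2 R I) : 0 < e ->
    (\forall t \near F, ell2_norm (y - x t) <= e) ->
    (sqnorm ((y : I -> R[i]) - l)%R <= (e ^+ 2)%:E)%E.
  move=> e0 xy; apply: esum_le_fset => A; rewrite lee_fin.
  (* The squared distance from [y] to [w] over [A], kept complex so that limits in [R[i]] apply to
     it. *)
  pose z (w : I -> R[i]) : R[i] := \sum_(i <- A) `|y i - w i| * `|y i - w i|.
  have zE w : z w = (\sum_(i <- A) normc (y i - w i) ^+ 2)%:C%C.
    by rewrite rmorph_sum; apply: eq_bigr => i _; rewrite rmorphXn expr2.
  have zl : (fun t => z (x t)) @ F --> z l.
    apply: cvg_big => [|i _]; first exact: add_continuous.
    have yx : (fun t => `|y i - x t i|) @ F --> `|y i - l i|.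
      by apply: cvg_norm; apply: cvgB => //; exact: cvg_cst.
    exact: cvgM.
  have := cvg_normc_le _ _ (e ^+ 2) zl; rewrite zE normc_real ger0_norm.
    apply; apply: filterS xy => t xy; rewrite zE normc_real ger0_norm.
      apply: le_trans (fset_le_ell2_norm (y - x t) A) _.
      by rewrite ler_sqr ?nnegrE ?ell2_norm_ge0// ltW.
    by apply: sumr_ge0 => i _; exact: sqr_ge0.
  by apply: sumr_ge0 => i _; exact: sqr_ge0.
have lS : l \in sqsummable.
  have [y xy] := xC _ ltr01.
  have yl : (y : I -> R[i]) - l \in sqsummable.
    by apply/asboolP; apply: le_lt_trans (ly _ _ ltr01 xy) _; exact: ltry.
  rewrite -[l](subKr (y : I -> R[i])) rpredB//; exact: (valP y).
pose L : ell2 R I := Ell2 lS.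
apply/cvg_ex; exists L; apply/cvg_ell2P => e e0.
have e30 : 0 < e / 3 by rewrite divr_gt0.
have [y xy] := xC _ e30.
have yL : ell2_norm (y - L) <= e / 3.
  rewrite -ler_sqr ?nnegrE ?ell2_norm_ge0 ?(ltW e30)// -lee_fin -sqnormE.
  exact: ly.
apply: filterS xy => t xy; rewrite -[L](subrK y) -addrA.
apply: le_lt_trans (ell2_normD _ _) _; rewrite ell2_norm_sub; lra.
Qed.

End Filters.
End Ell2Space.

(** * Bounded operators and their exponentials *)

Section OperatorExponential.
Context {R : realType}.

Section Convergence.
Context {I : choiceType} (T : ell2 R I -> ell2 R I) (C : R).
Hypotheses (C0 : 0 <= C) (TC : forall x, ell2_norm (T x) <= C * ell2_norm x).

Let exp_term (x : ell2 R I) (n : nat) : ell2 R I :=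
  (n`!%:R : R[i])^-1 *: iter n T x.

Lemma iter_norm_le n x : ell2_norm (iter n T x) <= C ^+ n * ell2_norm x.
Proof.
elim: n => [|n IHn] /=; first by rewrite mul1r.
by apply: le_trans (TC _) _; rewrite exprS -mulrA ler_wpM2l.
Qed.

Lemma exp_term_norm_le n x :
  ell2_norm (exp_term x n) <= exp_coeff C n * ell2_norm x.
Proof.
rewrite ell2_normZ normcV -(rmorph_nat (real_complex R)) normc_real ger0_norm//.
rewrite /exp_coeff /= mulrAC mulrC ler_wpM2r ?invr_ge0//.
exact: iter_norm_le.
Qed.

(** The terms are dominated by those of the scalar exponential series at [C], times the norm of [x],
    so the partial sums are Cauchy. *)
Lemma op_exp_cvg x : series (exp_term x) @ \oo --> op_exp T x.
Proof.
apply: cauchy_ell2_cvg => e e0.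
set u := series (exp_coeff C).
have u_nd : {homo u : n m / (n <= m)%N >-> n <= m}.
  move=> n m nm; rewrite -subr_ge0 sub_series_geq//.
  by apply: sumr_ge0 => k _; exact: exp_coeff_ge0.
have ucvg : cvgn u := is_cvg_series_exp_coeff C.
(* Adding 1 keeps the denominator positive when [x] is zero. *)
have d0 : 0 < e / (ell2_norm x + 1).
  by rewrite divr_gt0 ?ltr_wpDl ?ell2_norm_ge0.
have [N _ uN] : \forall n \near \oo, `|limn u - u n| < e / (ell2_norm x + 1).
  by move/cvgrPdist_lt : ucvg; exact.
exists (series (exp_term x) N); near=> n.
have Nn : (N <= n)%N by near: n; exact: nbhs_infty_ge.
rewrite ell2_norm_sub sub_series_geq//.
apply: le_trans (ell2_norm_sum _ _ _) _.
apply: (@le_trans _ _ ((u n - u N) * ell2_norm x)).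
  rewrite /u sub_series_geq// mulr_suml; apply: ler_sum => k _.
  exact: exp_term_norm_le.
apply: (@le_trans _ _ (e / (ell2_norm x + 1) * ell2_norm x)).
  apply: ler_wpM2r; first exact: ell2_norm_ge0.
  apply: le_trans (ltW (uN N (leqnn N))); apply: le_trans (ler_norm _).
  by rewrite lerD2r; exact: nondecreasing_cvgn_le.
rewrite mulrAC ler_pdivrMr ?ltr_wpDl ?ell2_norm_ge0//.
by rewrite ler_pM2l// lerDl.
Unshelve. all: by end_near. Qed.

Lemma op_expE x l : series (exp_term x) @ \oo --> l -> op_exp T x = l.
Proof. by move=> xl; apply: cvg_lim xl; exact: norm_hausdorff. Qed.

Lemma op_exp_linear : linear T -> linear (op_exp T).
Proof.
move=> Tlin a x y; apply: op_expE.
have iterlin n : iter n T (a *: x + y) = a *: iter n T x + iter n T y.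
  by elim: n => //= n ->; exact: Tlin.
have -> : series (exp_term (a *: x + y)) =
    (fun n => a *: series (exp_term x) n) + series (exp_term y).
  apply/funext => n.
  rewrite -[RHS]/(a *: series _ n + series _ n) /series /=.
  rewrite scaler_sumr -big_split.
  apply: eq_bigr => k _.
  by rewrite /exp_term iterlin scalerDr !scalerA mulrC.
by apply: cvgD; [apply: cvgZr; exact: op_exp_cvg|exact: op_exp_cvg].
Qed.

End Convergence.

(** [L] carries the partial sums for [S] to those for [T] and preserves their limit. The bound on
    [T] passes to [S] because [L] is isometric and [T L = L S]. *)
Lemma op_exp_intertwine {I J : choiceType} (T : ell2 R I -> ell2 R I)
    (S : ell2 R J -> ell2 R J) (L : ell2 R J -> ell2 R I) (C : R) :
  0 <= C -> (forall x, ell2_norm (T x) <= C * ell2_norm x) ->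
  linear L -> (forall x, ell2_norm (L x) = ell2_norm x) ->
  (forall x, T (L x) = L (S x)) ->
  forall x, op_exp T (L x) = L (op_exp S x).
Proof.
move=> C0 TC Llin Liso TL x.
have SC y : ell2_norm (S y) <= C * ell2_norm y by rewrite -!Liso -TL.
have L0 : L 0 = 0.
  have := Llin 1 0 0; rewrite !scale1r addr0 => /eqP.
  by rewrite eq_sym -subr_eq0 addrK => /eqP.
have LD y z : L (y + z) = L y + L z by rewrite -[y]scale1r Llin !scale1r.
have LZ a y : L (a *: y) = a *: L y by rewrite -[a *: y]addr0 Llin L0 addr0.
have LB y z : L (y - z) = L y - L z by rewrite LD -scaleN1r LZ scaleN1r.
have iterL n : iter n T (L x) = L (iter n S x) by elim: n => //= n ->.
apply: op_expE; apply/cvg_ell2P => e e0.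
have /cvg_ell2P /(_ e e0) := op_exp_cvg _ _ C0 SC x.
apply: filterS => n; rewrite -Liso LB /series /= (big_morph L LD L0).
by congr (ell2_norm (_ - _) < _); apply: eq_bigr => k _; rewrite LZ iterL.
Qed.

End OperatorExponential.

(** * Schur's test for real symmetric matrices with bounded absolute row sums *)

Section SchurTest.
Context {R : realType}.

(** Expand the nonnegative sum of [p i * (S / D - q i) ^+ 2]. Centring at [S / D] instead of the
    weighted mean [S / P] avoids the case [P = 0]. *)
Lemma weighted_cauchy_schwarz {I : Type} (r : seq I) (p q : I -> R) (D : R) :
  0 < D -> (forall i, 0 <= p i) -> \sum_(i <- r) p i <= D ->
  (\sum_(i <- r) p i * q i) ^+ 2 <= D * \sum_(i <- r) p i * q i ^+ 2.
Proof.
move=> D0 p0; set P := \sum_(i <- r) p i => PD.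
set S := \sum_(i <- r) _; set Q := \sum_(i <- r) _.
have : 0 <= \sum_(i <- r) p i * (S / D - q i) ^+ 2.
  by apply: sumr_ge0 => i _; rewrite mulr_ge0// sqr_ge0.
have -> : \sum_(i <- r) p i * (S / D - q i) ^+ 2 =
    (S / D) ^+ 2 * P - 2 * (S / D) * S + Q.
  move: (S / D) => k; rewrite /P /Q /S !mulr_sumr -sumrB -big_split /=.
  by apply: eq_bigr => i _; ring.
move=> PQ; have : (S / D) ^+ 2 * P <= (S / D) ^+ 2 * D.
  by rewrite ler_wpM2l// sqr_ge0.
have -> : (S / D) ^+ 2 * D = S ^+ 2 / D by field; rewrite gt_eqF.
move: PQ; have -> : 2 * (S / D) * S = 2 * (S ^+ 2 / D) by field; rewrite gt_eqF.
move=> PQ SD; rewrite -ler_pdivrMl// mulrC; lra.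
Qed.

Context {I : choiceType} (w : I -> I -> R) (D : R).
Hypotheses (D0 : 0 < D) (wC : forall a b, w a b = w b a).
Hypothesis (wD : forall a, (\esum_(b in [set: I]) `|w a b|%:E <= D%:E)%E).

Let M : imx R I I := fun a b => (w a b)%:C%C.

Let row_le a (A : {fset I}) : \sum_(b <- A) `|w a b| <= D.
Proof. by rewrite -lee_fin; apply: le_trans (wD a); exact: fset_le_esum. Qed.

(** The coordinates of [x] are at most its norm and row [a] has absolute sum at most [D], so the
    series converges absolutely. *)
Lemma real_imx_row_cvg (x : ell2 R I) a :
  partial_sum (fun b => M a b * x b) @ totally -->
  summability.sum (fun b => M a b * x b).
Proof.
apply: abs_summable_cvg; apply: (@le_lt_trans _ _ (ell2_norm x * D)%:E).
  apply: esum_le_fset => A; rewrite lee_fin.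
  apply: (@le_trans _ _ (\sum_(b <- A) ell2_norm x * `|w a b|)).
    apply: ler_sum => b _; rewrite normcM normc_real mulrC.
    by rewrite ler_wpM2r// normc_le_ell2_norm.
  by rewrite -mulr_sumr ler_wpM2l ?ell2_norm_ge0.
exact: ltry.
Qed.

Let Mx (x : ell2 R I) a := summability.sum (fun b => M a b * x b).

(** Cauchy-Schwarz weighted by the absolute entries of row [a] costs one factor [D]. Exchanging the
    two sums and bounding column sums by symmetry costs the other. *)
Lemma schur_test (x : ell2 R I) :
  (sqnorm (Mx x) <= (D ^+ 2 * ell2_norm x ^+ 2)%:E)%E.
Proof.
pose s a := \esum_(b in [set: I]) (`|w a b| * normc (x b) ^+ 2)%:E.
have s_fset a (A : {fset I}) :
    ((\sum_(b <- A) `|w a b| * normc (x b) ^+ 2)%:E <= s a)%E.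
  exact: fset_le_esum.
have s_fin a : s a \is a fin_num.
  rewrite ge0_fin_numE; last first.
    by apply: esum_ge0 => b _; rewrite lee_fin mulr_ge0// sqr_ge0.
  apply: (@le_lt_trans _ _ (ell2_norm x ^+ 2 * D)%:E); last exact: ltry.
  apply: esum_le_fset => A; rewrite lee_fin.
  apply: (@le_trans _ _ (\sum_(b <- A) ell2_norm x ^+ 2 * `|w a b|)).
    apply: ler_sum => b _; rewrite mulrC ler_wpM2r//.
    by rewrite ler_sqr ?nnegrE ?normc_ge0 ?ell2_norm_ge0// normc_le_ell2_norm.
  by rewrite -mulr_sumr ler_wpM2l// sqr_ge0.
have s0 a : 0 <= fine (s a).
  by rewrite fine_ge0// esum_ge0// => b _; rewrite lee_fin mulr_ge0// sqr_ge0.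
have Mx_le a : normc (Mx x a) ^+ 2 <= D * fine (s a).
  have Ds0 : 0 <= D * fine (s a) by rewrite mulr_ge0// ltW.
  rewrite -[leRHS]sqr_sqrtr// ler_sqr ?nnegrE ?normc_ge0 ?sqrtr_ge0//.
  (* The estimate is proved for every partial sum and passes to the limit. *)
  apply: cvg_normc_le (real_imx_row_cvg x a) _.
  apply: (near_totally _ fset0) => A _; rewrite partial_sumE.
  rewrite -ler_sqr ?nnegrE ?normc_ge0 ?sqrtr_ge0// sqr_sqrtr//.
  apply: (@le_trans _ _ ((\sum_(b <- A) `|w a b| * normc (x b)) ^+ 2)).
    rewrite ler_sqr ?nnegrE ?normc_ge0 ?sumr_ge0//; last first.
      by move=> b _; rewrite mulr_ge0// normc_ge0.
    apply: le_trans (normc_sum _ _ _) _.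
    by apply: ler_sum => b _; rewrite normcM normc_real.
  apply: le_trans (weighted_cauchy_schwarz _ _ _ _ D0 _ (row_le a A)) _ => //.
  by rewrite ler_pM2l// -lee_fin fineK.
apply: esum_le_fset => A.
apply: (@le_trans _ _ (D%:E * \sum_(a <- A) s a)%E).
  have -> : (\sum_(a <- A) s a)%E = (\sum_(a <- A) fine (s a))%:E.
    by rewrite -sumEFin; apply: eq_bigr => a _; rewrite fineK.
  rewrite -EFinM lee_fin mulr_sumr.
  by apply: ler_sum => a _; exact: Mx_le.
rewrite expr2 -mulrA EFinM lee_pmul2l// -esum_sum; last first.
  by move=> b a _ _; rewrite lee_fin mulr_ge0// sqr_ge0.
rewrite EFinM -sqnormE; apply: le_trans (esumZ_le (ltW D0) _); last first.
  by move=> b; exact: sqr_ge0.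
apply: le_esum => b _; rewrite sumEFin lee_fin -mulr_suml.
apply: ler_wpM2r; first exact: sqr_ge0.
by under eq_bigr do rewrite wC.
Qed.

(** Schur's bound makes the image square summable, so the default value 0 of [op_of_imx] is not
    taken. *)
Lemma op_of_real_imxE (x : ell2 R I) a :
  op_of_imx M x a = summability.sum (fun b => M a b * x b).
Proof.
rewrite /op_of_imx insubdK//; apply/asboolP.
by apply: le_lt_trans (schur_test x) _; exact: ltry.
Qed.

Lemma op_of_real_imx_cvg (x : ell2 R I) a :
  partial_sum (fun b => M a b * x b) @ totally --> op_of_imx M x a.
Proof. by rewrite op_of_real_imxE; exact: real_imx_row_cvg. Qed.

Lemma op_of_real_imx_norm_le (x : ell2 R I) :
  ell2_norm (op_of_imx M x) <= D * ell2_norm x.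
Proof.
rewrite -ler_sqr ?nnegrE ?mulr_ge0 ?ell2_norm_ge0 ?(ltW D0)//.
rewrite exprMn -lee_fin -sqnormE.
have -> : (op_of_imx M x : I -> R[i]) = Mx x.
  by apply/funext => a; exact: op_of_real_imxE.
exact: schur_test.
Qed.

Lemma op_of_real_imx_linear : linear (op_of_imx M).
Proof.
move=> c x y; apply: ell2_ext => a.
rewrite -[RHS]/(c * op_of_imx M x a + op_of_imx M y a) !op_of_real_imxE.
apply: sumE.
have -> : partial_sum (fun b => M a b * (c *: x + y) b) =
    (fun A => c * partial_sum (fun b => M a b * x b) A) +
    partial_sum (fun b => M a b * y b).
  apply/funext => A; rewrite -[RHS]/(c * partial_sum _ A + partial_sum _ A).
  rewrite !partial_sumE mulr_sumr -big_split /=.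
  by apply: eq_bigr => b _; rewrite mulrDr mulrCA.
by apply: cvgD; [apply: cvgMr; exact: real_imx_row_cvg|exact: real_imx_row_cvg].
Qed.

End SchurTest.

(** * Isometries with finitely supported disjoint columns *)

Section CellIsometry.
Context {R : realType} {V J : choiceType}.
Variables (cell : J -> {fset V}) (r : V -> J -> R).
Hypothesis cell_disj : forall j k v, v \in cell j -> v \in cell k -> j = k.
Hypothesis r_out : forall v j, v \notin cell j -> r v j = 0.
Hypothesis r_unit : forall j, \sum_(v <- cell j) r v j ^+ 2 = 1.

Let q : imx R V J := fun v j => (r v j)%:C%C.

(** Disjointness puts each vertex in at most one cell, so a finite set of vertices meets finitely
    many cells. *)
Lemma cells_meeting_fset (B : {fset V}) :
  exists A : {fset J}, forall v j, v \in B -> v \in cell j -> j \in A.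
Proof.
suff [A HA] : exists A : {fset J}, forall v j,
    v \in (enum_fset B) -> v \in cell j -> j \in A by exists A.
elim: (enum_fset B) => [|v s [A HA]]; first by exists fset0.
have [[j vj]|nv] := pselect (exists j, v \in cell j).
  exists (j |` A)%fset => u k; rewrite inE => /predU1P[->|us] uk.
    by rewrite (cell_disj _ _ _ uk vj) !inE eqxx.
  by rewrite !inE (HA u)// orbT.
exists A => u k; rewrite inE => /predU1P[->|us] uk; last exact: (HA u).
by case: nv; exists k.
Qed.

(** Take for [B'] the union of [B] and the cells indexed by [A']. Once [A'] contains the cells
    meeting [B], the leftover vertices lie in no cell and contribute 0. This lets unconditional
    limits over [V] be regrouped by cells. *)
Lemma sum_by_cells {M : zmodType} (x : V -> M) (B : {fset V}) :
  (forall v, (forall j, v \notin cell j) -> x v = 0) ->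
  exists A : {fset J}, forall A' : {fset J}, (A `<=` A')%fset ->
  exists2 B' : {fset V}, (B `<=` B')%fset &
    \sum_(v <- B') x v = \sum_(j <- A') \sum_(v <- cell j) x v.
Proof.
move=> x0; have [A HA] := cells_meeting_fset B; exists A => A' AA'.
pose B' := (B `|` \bigcup_(j <- A') cell j)%fset.
have cellB' j : j \in A' -> (cell j `<=` B')%fset.
  move=> jA; apply/fsubsetP => v vj; rewrite inE; apply/orP; right.
  by apply/bigfcupP; exists j; rewrite ?jA.
exists B'; first exact: fsubsetUl.
transitivity (\sum_(v <- B') \sum_(j <- A') if v \in cell j then x v else 0).
  apply: eq_big_seq => v vB'.
  have [[j vj]|nv] := pselect (exists j, v \in cell j); last first.
    rewrite x0; first by rewrite big1// => j _; case: ifP.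
    by move=> j; apply/negP => vj; apply: nv; exists j.
  have jA' : j \in A'.
    move: vB'; rewrite inE => /orP[vB|/bigfcupP[k /andP[kA' _] vk]].
      by apply: (fsubsetP AA'); exact: HA vj.
    by rewrite (cell_disj _ _ _ vj vk).
  rewrite (big_fsetD1 j)//= vj big_seq big1 ?addr0// => k.
  rewrite !inE => /andP[kj _]; case: ifP => // vk.
  by rewrite (cell_disj _ _ _ vk vj) eqxx in kj.
rewrite exchange_big; apply: eq_big_seq => j jA' /=.
rewrite -(big_fset_incl _ (cellB' j jA')) => [|v _ /negPf->//].
by apply: eq_big_seq => v ->.
Qed.

Lemma cvg_by_cells (x : V -> R[i]) (l : R[i]) :
  (forall v, (forall j, v \notin cell j) -> x v = 0) ->
  partial_sum x @ totally --> l ->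
  partial_sum (fun j => \sum_(v <- cell j) x v) @ totally --> l.
Proof.
move=> x0 /cvg_normcP xl; apply/cvg_normcP => e /xl[B _ xB].
have [A HA] := sum_by_cells x B x0.
apply: (near_totally _ A) => A' /HA[B' BB' xE].
by rewrite partial_sumE -xE -partial_sumE; exact: xB.
Qed.

(** Finite sums of nonnegative terms grow with the index set, so each kind of finite sum is
    dominated by one of the other kind supplied by [sum_by_cells]. *)
Lemma esum_by_cells (u : V -> R) :
  (forall v, 0 <= u v) -> (forall v, (forall j, v \notin cell j) -> u v = 0) ->
  \esum_(v in [set: V]) (u v)%:E =
  \esum_(j in [set: J]) (\sum_(v <- cell j) u v)%:E.
Proof.
move=> u0 uout; apply/eqP; rewrite eq_le; apply/andP; split.
  apply: esum_le_fset => B.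
  have [A /(_ A (fsubset_refl _))] := sum_by_cells u B uout.
  case=> B' BB' uE.
  apply: le_trans (fset_le_esum (fun j => \sum_(v <- cell j) u v) A).
  by rewrite lee_fin -uE (sum_fset_subset BB') lerDl sumr_ge0.
apply: esum_le_fset => A; have [A0 HA] := sum_by_cells u fset0 uout.
have [B _ uE] := HA _ (fsubsetUr A A0).
apply: le_trans (fset_le_esum u B); rewrite lee_fin uE.
rewrite (sum_fset_subset (fsubsetUl A A0)) lerDl sumr_ge0// => j _.
by rewrite sumr_ge0.
Qed.

(** The function underlying [op_of_imx q x], available for every [x] before square summability is
    known. *)
Let lift (x : J -> R[i]) (v : V) := summability.sum (fun j => q v j * x j).

Lemma lift_cell {x v j} : v \in cell j -> lift x v = q v j * x j.
Proof.
move=> vj; rewrite /lift (sum_finite_support _ [fset j]%fset) ?big_seq_fset1//.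
move=> k; rewrite inE => kj; rewrite /q r_out ?mul0r//.
by apply: contra kj => vk; rewrite (cell_disj _ _ _ vk vj).
Qed.

Lemma lift_out {x v} : (forall j, v \notin cell j) -> lift x v = 0.
Proof.
move=> nv; rewrite /lift (sum_finite_support _ fset0) ?big_seq_fset0//.
by move=> k _; rewrite /q r_out ?mul0r.
Qed.

Lemma cell_imx_unit j : \sum_(v <- cell j) q v j * q v j = 1.
Proof.
rewrite -(rmorph1 (real_complex R)) -(r_unit j) rmorph_sum.
by apply: eq_bigr => v _; rewrite rmorphXn expr2.
Qed.

(** In matrix form, [q^T q = 1]; [x] is an arbitrary function, so this applies directly to columns
    of transition matrices. *)
Lemma cell_coord x j : \sum_(v <- cell j) q v j * lift x v = x j.
Proof.
rewrite -[RHS]mul1r -(cell_imx_unit j) mulr_suml.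
by apply: eq_big_seq => v vj; rewrite (lift_cell vj) mulrA.
Qed.

Lemma sqnorm_lift x : sqnorm (lift x) = sqnorm x.
Proof.
rewrite /sqnorm esum_by_cells; last 2 first.
- by move=> v; exact: sqr_ge0.
- by move=> v /lift_out ->; rewrite normc0 expr0n.
apply: eq_esum => j _; congr (_%:E).
rewrite -[RHS]mul1r -(r_unit j) mulr_suml; apply: eq_big_seq => v vj.
by rewrite (lift_cell vj) normcM exprMn normc_real real_normK ?num_real.
Qed.

Lemma op_of_cell_imxE (x : ell2 R J) v : op_of_imx q x v = lift x v.
Proof.
rewrite /op_of_imx insubdK//; apply/asboolP.
by rewrite -/(lift x) sqnorm_lift sqnormE ltry.
Qed.

Lemma op_of_cell_imx_iso (x : ell2 R J) :
  ell2_norm (op_of_imx q x) = ell2_norm x.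
Proof.
rewrite /ell2_norm -sqnorm_lift; congr (Num.sqrt (fine (sqnorm _))).
by apply/funext => v; exact: op_of_cell_imxE.
Qed.

Lemma op_of_cell_imx_linear : linear (op_of_imx q).
Proof.
move=> c x y; apply: ell2_ext => v.
rewrite -[RHS]/(c * op_of_imx q x v + op_of_imx q y v) !op_of_cell_imxE.
have [[j vj]|nv] := pselect (exists j, v \in cell j).
  by rewrite !(lift_cell vj) mulrDr mulrCA.
have nv' j : v \notin cell j by apply/negP => vj; apply: nv; exists j.
by rewrite !lift_out// mulr0 addr0.
Qed.

Lemma op_of_cell_imx_basis j :
  op_of_imx q (basis_vec j) = \sum_(v <- cell j) q v j *: basis_vec v.
Proof.
apply: ell2_ext => v; rewrite op_of_cell_imxE ell2_sumE.
have basisE u : (q u j *: basis_vec u : ell2 R V) v = q u j * (v == u)%:R by [].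
under eq_bigr do rewrite basisE.
have [vj|nvj] := boolP (v \in cell j).
  rewrite (lift_cell vj) (big_fsetD1 v)//= !eqxx big_seq big1 ?addr0// => u.
  by rewrite !inE eq_sym => /andP[/negPf-> _]; rewrite mulr0.
rewrite big_seq big1 => [|u uj]; last first.
  by rewrite (_ : v == u = false) ?mulr0//; apply: contraNF nvj => /eqP->.
have [[k vk]|nv] := pselect (exists k, v \in cell k).
  rewrite (lift_cell vk) /= (_ : k == j = false) ?mulr0//.
  by apply: contraNF nvj => /eqP<-.
by rewrite lift_out// => k; apply/negP => vk; apply: nv; exists k.
Qed.

(** * Passing an intertwining relation from matrix entries to exponentials *)

Section Intertwining.
Variables (w : V -> V -> R) (D : R) (N : imx R J J).
Hypotheses (D0 : 0 < D) (wC : forall a b, w a b = w b a).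
Hypothesis (wD : forall a, (\esum_(b in [set: V]) `|w a b|%:E <= D%:E)%E).
(** Together, [wN] and [w_out] express [M q = q N] entrywise: row [v] of [q] is zero when [v] lies
    in no cell. *)
Hypothesis wN : forall v k j, v \in cell k ->
  \sum_(u <- cell j) (w v u)%:C%C * q u j = q v k * N k j.
Hypothesis w_out : forall v j, (forall k, v \notin cell k) ->
  \sum_(u <- cell j) (w v u)%:C%C * q u j = 0.

Let M : imx R V V := fun a b => (w a b)%:C%C.

(* [op_of_imx N] is not known to be bounded beforehand: summing the series of
   [M (q x)] cell by cell shows that [N x] is defined and that [q] maps it to
   [M (q x)], and [q] is isometric. *)
Lemma op_of_imx_intertwine (x : ell2 R J) :
  op_of_imx M (op_of_imx q x) = op_of_imx q (op_of_imx N x).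
Proof.
pose y := op_of_imx q x; pose l v := op_of_imx M y v.
have yout v : (forall j, v \notin cell j) -> y v = 0.
  by move=> nv; rewrite /y op_of_cell_imxE lift_out.
(* The series for [M y] is regrouped by cells; on cell [j], [y] is [x j] times column [j] of [q]. *)
have l_cvg v : partial_sum
    (fun j => (\sum_(u <- cell j) M v u * q u j) * x j) @ totally --> l v.
  rewrite (_ : (fun j => _) = fun j => \sum_(u <- cell j) M v u * y u).
    apply: cvg_by_cells => [u nu|]; first by rewrite yout// mulr0.
    exact: (op_of_real_imx_cvg _ _ D0 wC wD y v).
  apply/funext => j; rewrite mulr_suml; apply: eq_big_seq => u uj.
  by rewrite /y op_of_cell_imxE (lift_cell uj) mulrA.
have l_out v : (forall j, v \notin cell j) -> l v = 0.
  move=> nv; have := l_cvg v.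
  rewrite (_ : (fun j => _) = fun=> 0); last first.
    by apply/funext => j; rewrite w_out// mul0r.
  by move=> /sumE <-; rewrite (sum_finite_support _ fset0)// big_seq_fset0.
have qN_cvg v k : v \in cell k ->
    (fun A => q v k * partial_sum (fun j => N k j * x j) A) @ totally --> l v.
  move=> vk; rewrite (_ : (fun A => _) = partial_sum
      (fun j => (\sum_(u <- cell j) M v u * q u j) * x j)); first exact: l_cvg.
  apply/funext => A.
  rewrite !partial_sumE mulr_sumr; apply: eq_bigr => j _.
  by rewrite (wN _ _ _ vk) mulrA.
pose m k := summability.sum (fun j => N k j * x j).
have m_cvg k : partial_sum (fun j => N k j * x j) @ totally --> m k.
  set S := partial_sum _.
  (* The squares of [q v k] over the cell sum to 1, so [S] is a finite combination of the convergent
     families [q v k * S]. This avoids dividing by a possibly zero [q v k]. *)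
  have SE A : S A = \sum_(v <- cell k) q v k * (q v k * S A).
    by under eq_bigr do rewrite mulrA; rewrite -mulr_suml cell_imx_unit mul1r.
  apply/cvg_ex; exists (\sum_(v <- cell k) q v k * l v).
  rewrite (funext SE) big_seq; under eq_fun do rewrite big_seq.
  apply: cvg_big => [|v vk]; first exact: add_continuous.
  by apply: cvgMr; exact: qN_cvg.
have lE v k : v \in cell k -> l v = q v k * m k.
  move=> vk; have /cvg_lim <- := qN_cvg v k vk; last exact: norm_hausdorff.
  by apply: cvg_lim; [exact: norm_hausdorff|apply: cvgMr; exact: m_cvg].
have liftm : lift m = l.
  apply/funext => v; have [[k vk]|nv] := pselect (exists k, v \in cell k).
    by rewrite (lift_cell vk) (lE _ _ vk).
  have nv' k : v \notin cell k by apply/negP => vk; apply: nv; exists k.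
  by rewrite lift_out// l_out.
(* The lift of [m] is the square-summable [l], so [m] is square summable and the default value of
   [op_of_imx] is avoided. *)
have NE : (op_of_imx N x : J -> R[i]) = m.
  rewrite /op_of_imx insubdK//; apply/asboolP.
  by rewrite -[fun i => _]/m -sqnorm_lift liftm /l sqnormE ltry.
by apply: ell2_ext => v; rewrite op_of_cell_imxE NE liftm.
Qed.

(** Column [j] of [U_M q = q U_N]. The intertwining of exponentials is evaluated at [basis_vec j],
    whose image under [q] is a finite combination of basis vectors. *)
Lemma transition_imx_intertwine (t : R) v j :
  \sum_(u <- cell j) transition_imx M t v u * q u j =
  lift (fun k => transition_imx N t k j) v.
Proof.
set z := (0 +i* t)%C.
pose T (x : ell2 R V) := z *: op_of_imx M x.
pose S (x : ell2 R J) := z *: op_of_imx N x.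
have C0 : 0 <= normc z * D by rewrite mulr_ge0 ?normc_ge0// ltW.
have TC x : ell2_norm (T x) <= normc z * D * ell2_norm x.
  rewrite ell2_normZ -mulrA ler_wpM2l ?normc_ge0//.
  exact: op_of_real_imx_norm_le.
have Tlin : linear T.
  move=> c x y; rewrite /T (op_of_real_imx_linear _ _ D0 wC wD) scalerDr.
  by rewrite !scalerA [z * c]mulrC.
have TS x : T (op_of_imx q x) = op_of_imx q (S x).
  rewrite /T /S op_of_imx_intertwine.
  have := op_of_cell_imx_linear z (op_of_imx N x) 0; rewrite addr0 => ->.
  have q0 : op_of_imx q 0 = 0.
    by apply: ell2_norm_eq0; rewrite op_of_cell_imx_iso ell2_norm0.
  by rewrite q0 addr0.
have expq := op_exp_intertwine _ _ _ _ C0 TC op_of_cell_imx_linear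
  op_of_cell_imx_iso TS (basis_vec j).
have expT := op_exp_linear _ _ C0 TC Tlin.
have expT0 : op_exp T 0 = 0.
  have := expT 1 0 0; rewrite !scale1r addr0 => /eqP.
  by rewrite eq_sym -subr_eq0 addrK => /eqP.
have expT_sum (s : seq V) (c : V -> R[i]) (y : V -> ell2 R V) :
    op_exp T (\sum_(u <- s) c u *: y u) = \sum_(u <- s) c u *: op_exp T (y u).
  by elim: s => [|u s IHs]; rewrite ?big_nil// !big_cons expT IHs.
rewrite -[RHS]/(lift (op_exp S (basis_vec j)) v) -op_of_cell_imxE -expq.
rewrite op_of_cell_imx_basis expT_sum ell2_sumE.
by apply: eq_bigr => u _; rewrite mulrC.
Qed.

End Intertwining.
End CellIsometry.

(** * Twin cells and equitable cells *)

Lemma big_fset2 {I : choiceType} {M : zmodType} (x : I -> M) (a b : I) :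
  a != b -> \sum_(i <- [fset a; b]%fset) x i = x a + x b.
Proof. by move=> ab; rewrite big_fsetU1 ?big_seq_fset1// inE. Qed.

(** Finite column supports turn both unconditional sums into finite ones, which may be exchanged.
    The grouping [Q^T (U Q)] exposes the inner sum to which the intertwining relations apply. *)
Lemma imx_mul_finite_columns {R : realType} {V P : choiceType}
    (Q : imx R V P) (U : imx R V V) (supp : P -> {fset V}) :
  (forall v p, v \notin supp p -> Q v p = 0) -> forall p p',
  imx_mul (imx_mul (imx_tr Q) U) Q p p' =
  \sum_(v <- supp p) Q v p * \sum_(u <- supp p') U v u * Q u p'.
Proof.
move=> Q0 p p'; rewrite /imx_mul /imx_tr.
rewrite (sum_finite_support _ (supp p')) => [|u up']; last first.
  by rewrite (Q0 u p')// mulr0.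
transitivity (\sum_(u <- supp p') \sum_(v <- supp p) Q v p * U v u * Q u p').
  apply: eq_bigr => u _; rewrite -mulr_suml; congr (_ * _).
  by apply: sum_finite_support => v vp; rewrite (Q0 v p)// mul0r.
rewrite exchange_big; apply: eq_bigr => v _; rewrite mulr_sumr.
by apply: eq_bigr => u _; rewrite mulrA.
Qed.

Section TwinCells.
Context {R : realType} {V : countType}.
Variables (G : graph R V) (X1 X2 : set V) (f : V -> V).
Hypothesis twinsX : edge_perturbed_twins G X1 X2 f.

Definition twin_cell (a : X1) : {fset V} := [fset val a; f (val a)]%fset.

Definition twin_coeff (v : V) (a : X1) : R :=
  (Num.sqrt 2)^-1 * ((v == val a)%:R - (v == f (val a))%:R).

Lemma twin_swapE (a : X1) : twin_swap X1 X2 f (val a) = f (val a).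
Proof. by rewrite /twin_swap (valP a). Qed.

Lemma twin_imxE : twin_imx X1 X2 f = fun v a => (twin_coeff v a)%:C%C.
Proof.
by apply/funext => v; apply/funext => a; rewrite /twin_imx twin_swapE.
Qed.

Lemma twin_in1 (a : X1) : X1 (val a).
Proof. by have := valP a; rewrite inE. Qed.

Lemma twin_in2 (a : X1) : X2 (f (val a)).
Proof. by have [+ _ _] := twins_bij twinsX; apply; exact: twin_in1. Qed.

Lemma twin_disj v : X1 v -> X2 v -> False.
Proof.
move=> v1 v2; have := twins_disjoint twinsX.
by move=> /seteqP[+ _] => /(_ v); exact.
Qed.

Lemma twin_neq (a b : X1) : val a != f (val b).
Proof.
apply/eqP => ab; apply: (@twin_disj (val a)); first exact: twin_in1.
by rewrite ab; exact: twin_in2.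
Qed.

Lemma twin_cell_disj (a b : X1) v :
  v \in twin_cell a -> v \in twin_cell b -> a = b.
Proof.
rewrite !inE => /orP[/eqP->|/eqP->] /orP[].
- by move=> /eqP /val_inj.
- by rewrite (negPf (twin_neq _ _)).
- by rewrite eq_sym (negPf (twin_neq _ _)).
move=> /eqP ab; apply: val_inj; have [_ finj _] := twins_bij twinsX.
by apply: finj ab; rewrite inE; exact: twin_in1.
Qed.

Lemma twin_coeff_out v a : v \notin twin_cell a -> twin_coeff v a = 0.
Proof.
rewrite !inE negb_or /twin_coeff => /andP[/negPf-> /negPf->].
by rewrite subrr mulr0.
Qed.

Lemma twin_coeff1 a : twin_coeff (val a) a = (Num.sqrt 2)^-1.
Proof. by rewrite /twin_coeff eqxx (negPf (twin_neq _ _)) subr0 mulr1. Qed.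

Lemma twin_coeff2 a : twin_coeff (f (val a)) a = - (Num.sqrt 2)^-1.
Proof.
by rewrite /twin_coeff eqxx eq_sym (negPf (twin_neq _ _)) sub0r mulrN1.
Qed.

Lemma twin_coeff_unit a : \sum_(v <- twin_cell a) twin_coeff v a ^+ 2 = 1.
Proof.
rewrite big_fset2 ?twin_neq// twin_coeff1 twin_coeff2 sqrrN exprVn sqr_sqrtr//.
by field.
Qed.

Lemma twin_cellsP v :
  (exists a : X1, v = val a \/ v = f (val a)) \/ (~ X1 v /\ ~ X2 v).
Proof.
have [v1|v1] := pselect (X1 v).
  by left; exists (SigSub (mem_set v1)); left.
have [v2|v2] := pselect (X2 v); last by right.
have [_ _ /(_ v v2)[u u1 <-]] := twins_bij twinsX.
by left; exists (SigSub (mem_set u1)); right.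
Qed.

Lemma adj_twin v (a : X1) :
  \sum_(u <- twin_cell a) (G v u)%:C%C * (twin_coeff u a)%:C%C =
  ((Num.sqrt 2)^-1 * (G v (val a) - G v (f (val a))))%:C%C.
Proof.
rewrite big_fset2 ?twin_neq// twin_coeff1 twin_coeff2 -!rmorphM -rmorphD /=.
by congr (_%:C)%C; ring.
Qed.

(** At [val k] the difference of weights is the required entry. At [f (val k)], [twins_inner] and
    [twins_cross] reverse its sign, matching the negative value of [twin_coeff]. *)
Lemma adj_twin_cell v k a : v \in twin_cell k ->
  \sum_(u <- twin_cell a) (G v u)%:C%C * (twin_coeff u a)%:C%C =
  (twin_coeff v k)%:C%C *
    (adj_imx (induced_subgraph G X1) - cross_imx G X1 f) k a.
Proof.
rewrite adj_twin.
have -> : (adj_imx (induced_subgraph G X1) - cross_imx G X1 f) k a =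
    (G (val k) (val a) - G (val k) (f (val a)))%:C%C.
  by rewrite rmorphB.
have k1 := twin_in1 k; have a1 := twin_in1 a.
rewrite !inE => /orP[/eqP->|/eqP->]; rewrite -rmorphM.
  by rewrite twin_coeff1.
rewrite twin_coeff2 (twins_inner twinsX)// -(twins_cross twinsX)//.
by congr (_%:C)%C; ring.
Qed.

(** A vertex outside both twins has equal weights to [val a] and [f (val a)], so the two terms
    cancel. *)
Lemma adj_twin_out v a : (forall k, v \notin twin_cell k) ->
  \sum_(u <- twin_cell a) (G v u)%:C%C * (twin_coeff u a)%:C%C = 0.
Proof.
move=> nv; rewrite adj_twin.
have [[k vk]|[v1 v2]] := twin_cellsP v.
  by have := nv k; rewrite !inE; case: vk => ->; rewrite eqxx ?orbT.
rewrite (weight_sym G v (f _)) (twins_outer twinsX)//; last exact: twin_in1.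
by rewrite (weight_sym G v) subrr mulr0.
Qed.

End TwinCells.

Section EquitableCells.
Context {R : realType} {V J : countType}.
Variables (G : graph R V) (cell : J -> {fset V}) (c : J -> J -> R).
Hypothesis equitableP : equitable G cell c.

Definition char_coeff (v : V) (j : J) : R :=
  (Num.sqrt (#|` cell j|)%:R)^-1 * (v \in cell j)%:R.

Lemma equitable_disj j k v : v \in cell j -> v \in cell k -> j = k.
Proof.
have [[_ triv _] _] := equitableP.
by move=> vj vk; apply: (triv j k) => //; exists v.
Qed.

Lemma equitable_cover v : exists j, v \in cell j.
Proof.
have [[cov _ _] _] := equitableP.
by have : [set: V] v by []; rewrite -cov => -[j _ vj]; exists j.
Qed.

Lemma equitable_card_gt0 j : 0 < (#|` cell j|)%:R :> R.
Proof.
have [[_ _ /(_ j I)[v vj]] _] := equitableP.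
by rewrite ltr0n cardfs_gt0; apply/fset0Pn; exists v.
Qed.

Lemma char_coeff_out v j : v \notin cell j -> char_coeff v j = 0.
Proof. by rewrite /char_coeff => /negPf->; rewrite mulr0. Qed.

Lemma char_coeff_cell v j :
  v \in cell j -> char_coeff v j = (Num.sqrt (#|` cell j|)%:R)^-1.
Proof. by rewrite /char_coeff => ->; rewrite mulr1. Qed.

Lemma char_coeff_unit j : \sum_(v <- cell j) char_coeff v j ^+ 2 = 1.
Proof.
have n0 := equitable_card_gt0 j.
rewrite (eq_big_seq (fun=> (#|` cell j|)%:R^-1)) => [|v vj]; last first.
  by rewrite char_coeff_cell// exprVn sqr_sqrtr// ltW.
rewrite big_const_seq count_predT iter_addr_0.
by rewrite -[LHS]mulr_natr mulVf// gt_eqF.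
Qed.

(** Both sides are the total weight between the two cells, summed from either end. *)
Lemma equitable_double_count j k :
  (#|` cell j|)%:R * c j k = (#|` cell k|)%:R * c k j.
Proof.
have [_ cE] := equitableP.
have E i l :
    (#|` cell i|)%:R * c i l = \sum_(a <- cell i) \sum_(b <- cell l) G a b.
  rewrite (eq_big_seq (fun=> c i l)) => [|a ai]; last exact: cE.
  by rewrite big_const_seq count_predT iter_addr_0 mulr_natl.
rewrite !E exchange_big; apply: eq_bigr => a _; apply: eq_bigr => b _.
exact: weight_sym.
Qed.

(** Double counting turns [c k j * c j k] into [c k j ^+ 2] times the ratio of the cell sizes. Its
    root is the absolute value of [c k j] times the ratio of the normalizations, and the sign factor
    restores [c k j]. *)
Lemma adj_char_cell v k j : v \in cell k ->
  \sum_(u <- cell j) (G v u)%:C%C * (char_coeff u j)%:C%C =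
  (char_coeff v k)%:C%C * quotient_imx c k j.
Proof.
move=> vk; have [_ cE] := equitableP.
have nk := equitable_card_gt0 k; have nj := equitable_card_gt0 j.
rewrite (eq_big_seq (fun u => (G v u * (Num.sqrt (#|` cell j|)%:R)^-1)%:C%C));
  last first.
  by move=> u uj; rewrite char_coeff_cell// rmorphM.
rewrite -rmorph_sum -mulr_suml (cE k)// char_coeff_cell// -rmorphM.
congr (_%:C)%C.
set nk' : R := (#|` cell k|)%:R in nk *.
set nj' : R := (#|` cell j|)%:R in nj *.
have -> : c k j * c j k = c k j ^+ 2 * (nk' / nj').
  have -> : c j k = nk' * c k j / nj'.
    by rewrite equitable_double_count mulrC mulKf// gt_eqF.
  by ring.
rewrite sqrtrM ?sqr_sqrtr ?sqr_ge0// sqrtr_sqr sqrtrM ?ltW// sqrtrV ?ltW//.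
have -> : forall x y : R,
    (Num.sqrt nk')^-1 * (Num.sg x * (`|x| * (Num.sqrt nk' * y))) =
    (Num.sg x * `|x|) * y * ((Num.sqrt nk')^-1 * Num.sqrt nk') by move=> *; ring.
by rewrite -numEsg mulVf ?mulr1// gt_eqF// sqrtr_gt0.
Qed.

(** Vacuous, since the cells of a partition cover [V]. *)
Lemma adj_char_out v j : (forall k, v \notin cell k) ->
  \sum_(u <- cell j) (G v u)%:C%C * (char_coeff u j)%:C%C = 0.
Proof.
by move=> nv; have [k vk] := equitable_cover v; have := nv k; rewrite vk.
Qed.

End EquitableCells.

(** * Assembly of the four blocks *)

Theorem theorem2p2 (R : realType) (V : countType) (G : graph R V)
    (X1 X2 : set V) (f : V -> V)
    (J : countType) (cell : J -> {fset V}) (c : J -> J -> R)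
    (boundedG : bounded_graph G)
    (twinsX : edge_perturbed_twins G X1 X2 f)
    (equitableP : equitable G cell c)
    (twin_cells : forall a, X1 a ->
      exists j, cell j = [fset a; twin_swap X1 X2 f a]%fset) :
  let Q := imx_row (twin_imx X1 X2 f) (char_imx cell) in
  let U' := transition_imx (adj_imx (induced_subgraph G X1) - cross_imx G X1 f) in
  forall t : R,
    imx_mul (imx_mul (imx_tr Q) (transition_imx (adj_imx G) t)) Q =
    imx_diag (U' t) (transition_imx (quotient_imx c) t).
Proof.
move=> Q U' t.
(* The maximum with 1 provides the strictly positive bound required by Schur's test. *)
have [_ [D' wD']] := boundedG; pose D := Num.max D' 1.
have D0 : 0 < D by rewrite lt_max ltr01 orbT.
have wD a : (\esum_(b in [set: V]) `|G a b|%:E <= D%:E)%E.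
  by apply: le_trans (wD' a) _; rewrite lee_fin le_max lexx.
have twin_cell_eq (a : X1) : exists j, cell j = twin_cell X1 f a.
  have [j jE] := twin_cells _ (twin_in1 X1 a).
  by exists j; rewrite jE twin_swapE.
have tdisj := twin_cell_disj G X1 X2 f twinsX.
have tout := twin_coeff_out (R := R) X1 f.
have tunit := twin_coeff_unit G X1 X2 f twinsX.
have cdisj := equitable_disj G cell c equitableP.
have cout := char_coeff_out (R := R) cell.
have cunit := char_coeff_unit G cell c equitableP.
have UB := transition_imx_intertwine _ _ tdisj tout tunit _ _ _ D0
  (weight_sym G) wD (adj_twin_cell G X1 X2 f twinsX)
  (adj_twin_out G X1 X2 f twinsX) t.
have UC := transition_imx_intertwine _ _ cdisj cout cunit _ _ _ D0
  (weight_sym G) wD (adj_char_cell G cell c equitableP)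
  (adj_char_out G cell c equitableP) t.
pose supp (p : X1 + J) := match p with
  | inl a => twin_cell X1 f a | inr j => cell j end.
apply/funext => p; apply/funext => p'.
rewrite (imx_mul_finite_columns _ _ supp); last first.
  move=> v [a|j] vp /=; first by rewrite twin_imxE tout.
  by rewrite /char_imx (negPf vp) mulr0.
rewrite /Q twin_imxE; case: p p' => [a|j] [b|k] /=.
(* Block [B^T U B]: after [U B = B U'], only [B^T B = 1] remains. *)
- under eq_bigr do rewrite UB.
  exact: (cell_coord _ _ tdisj tout tunit).
(* Block [B^T U C]: the columns of [U C] are constant on the cell formed by [val a] and [f (val a)],
   where the entries of [B] are opposite. *)
- under eq_bigr do rewrite UC.
  have [i iE] := twin_cell_eq a.
  rewrite big_fset2 ?(twin_neq G X1 X2 f twinsX)//.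
  rewrite (twin_coeff1 G X1 X2 f twinsX) (twin_coeff2 G X1 X2 f twinsX).
  have i1 : val a \in cell i by rewrite iE !inE eqxx.
  have i2 : f (val a) \in cell i by rewrite iE !inE eqxx orbT.
  rewrite !(lift_cell _ _ cdisj cout i1, lift_cell _ _ cdisj cout i2).
  by rewrite !char_coeff_cell// rmorphN mulNr subrr.
(* Block [C^T U B]: on a twin cell, the two values of a column of [U B] are opposite and cancel. *)
- under eq_bigr do rewrite UB.
  have [[a jE]|nj] := pselect (exists a : X1, cell j = twin_cell X1 f a).
    rewrite jE big_fset2 ?(twin_neq G X1 X2 f twinsX)//.
    have i1 : val a \in twin_cell X1 f a by rewrite !inE eqxx.
    have i2 : f (val a) \in twin_cell X1 f a by rewrite !inE eqxx orbT.
    rewrite /char_imx jE i1 i2.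
    rewrite !(lift_cell _ _ tdisj tout i1, lift_cell _ _ tdisj tout i2).
    rewrite (twin_coeff1 G X1 X2 f twinsX) (twin_coeff2 G X1 X2 f twinsX).
    by rewrite rmorphN mulNr mulrN subrr.
  (* Any other cell of the partition is disjoint from all twin cells, and the columns of [U B]
     vanish there. *)
  rewrite big_seq big1// => v vj; rewrite (lift_out _ _ tout) ?mulr0// => a.
  apply/negP => va; apply: nj; exists a; have [i iE] := twin_cell_eq a.
  by rewrite -iE; congr cell; apply: cdisj vj _; rewrite iE.
(* Block [C^T U C]: the quotient's transition matrix is left by [C^T C = 1]. *)
- under eq_bigr do rewrite UC.
  exact: (cell_coord _ _ cdisj cout cunit).
Qed.
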